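(* Let $X$ be a compact Hausdorff space. If $\dim X\geqslant 2$, then multiplication in $C(X)$ is not open. (This holds both for the algebra of real-valued and for the algebra of complex-valued continuous functions.)
   Context: $C(X)$ is the Banach algebra of all continuous scalar-valued functions on $X$ with pointwise operations and the supremum norm; the scalars may be real or complex. $\dim X$ is the covering (Lebesgue) dimension of $X$. Multiplication in a Banach algebra $A$ is open if the map $A\times A\to A$, $(a,b)\mapsto ab$, sends open sets to open sets; equivalently, for all $x,y\in A$ and $\varepsilon>0$ there is $\delta>0$ with $B(xy,\delta)\subseteq B(x,\varepsilon)\cdot B(y,\varepsilon)$, where $B(x,r)$ is the open ball and $U\cdot V=\{uv\colon u\in U,v\in V\}$. *)

(* Defs.v *)
From HB Require Import structures.
From mathcomp Require Import all_boot all_order all_algebra.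
From mathcomp Require Import all_classical all_reals all_analysis.
From mathcomp Require Export complex.

Set Implicit Arguments.
Unset Strict Implicit.
Unset Printing Implicit Defensive.

Import Order.TTheory GRing.Theory Num.Theory.
Import numFieldNormedType.Exports.

Local Open Scope classical_set_scope.
Local Open Scope ring_scope.

Section continuous_sub.
Context {X Y : topologicalType}.

Definition cfun : {pred X -> Y} := mem [set f | continuous f].
Definition cfun_key : pred_key cfun. Proof. exact. Qed.
Canonical cfun_keyed := KeyedPred cfun_key.

Section Sub.
Context (f : X -> Y) (fP : f \in cfun).
Definition cfun_Sub_subproof := @isContinuous.Build X Y f (set_mem fP).
#[local] HB.instance Definition _ := cfun_Sub_subproof.
Definition cfun_Sub : continuousType X Y := f.
End Sub.

Lemma cfun_rect (P : continuousType X Y -> Type) :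
  (forall f (Pf : f \in cfun), P (cfun_Sub Pf)) -> forall u, P u.
Proof.
move=> Psub [f [[Pf]]].
have -> : Pf = set_mem (mem_set Pf : f \in cfun) by [].
exact: Psub.
Qed.

Lemma cfun_valP f (Pf : f \in cfun) : cfun_Sub Pf = f :> (_ -> _).
Proof. by []. Qed.

HB.instance Definition _ :=
  isSub.Build _ _ (continuousType X Y) cfun_rect cfun_valP.
End continuous_sub.

(* The scalars are any K : numFieldType; K = R and K = R[i] are the intended
   cases. Both carry the topology of their absolute value. *)
Section continuous_ring.
Context (X : topologicalType) (K : numFieldType).

Lemma cfun_subring_closed : subring_closed (@cfun X K).
Proof.
split=> [|f g|f g]; rewrite ?inE/=.
- by move=> x; exact: cvg_cst.
- by move=> cf cg x; exact: (cvgB (cf x) (cg x)).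
- by move=> cf cg x; exact: (cvgM (cf x) (cg x)).
Qed.

HB.instance Definition _ :=
  GRing.isSubringClosed.Build _ (@cfun X K) cfun_subring_closed.
HB.instance Definition _ := GRing.SubChoice_isSubComPzRing.Build
  (X -> K) (@cfun X K) (continuousType X K) cfun_subring_closed.

End continuous_ring.

Lemma cfunB (X : topologicalType) (K : numFieldType)
    (f g : continuousType X K) (x : X) : (f - g) x = f x - g x.
Proof. by []. Qed.

Lemma cfunM (X : topologicalType) (K : numFieldType)
    (f g : continuousType X K) (x : X) : (f * g) x = f x * g x.
Proof. by []. Qed.

(* As for every norm over K in the library, the value lies in K. For K = R this
   is [sup]; for K = R[i] the supremum is taken for the partial order of R[i],
   and agrees with the one of the real moduli (sup_normC). *)
Definition sup_norm (X : topologicalType) (K : numFieldType)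
  (f : continuousType X K) : K := supremum 0 (range (fun x => `|f x|)).

Lemma sup_normR (R : realType) (X : topologicalType) (f : continuousType X R) :
  sup_norm f = sup (range (fun x => `|f x|)).
Proof. by []. Qed.

Lemma sup_normC (R : realType) (X : topologicalType)
    (f : continuousType X (R[i] : numFieldType)) :
  sup_norm f = (sup (range (fun x => Normc.normc (f x))))%:C%C.
Proof.
rewrite /sup_norm; set B := (X in supremum _ X); set A := (X in sup X).
have BA : B = (fun r : R => r%:C%C) @` A.
  apply/seteqP; split=> [_ [x _ <-]|_ [_ [x _ <-] <-]]; last by exists x.
  by exists (Normc.normc (f x)) => //; exists x.
have [A0|/set0P[a Aa]] := eqVneq A set0.
  by rewrite BA A0 image_set0 supremum0 sup0.
have [supA|nsupA] := pselect (has_sup A); last first.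
  rewrite (sup_out nsupA) supremum_out// => -[_ [b ub_b]]; apply: nsupA.
  split; [by exists a|exists (complex.Re b) => r Ar].
  have : r%:C%C <= b by apply: ub_b; rewrite BA; exists r.
  by case: b {ub_b} => b1 b2; rewrite lecE/= => /andP[].
have supB : supremums B (sup A)%:C%C.
  split.
    move=> s; rewrite BA => -[r Ar <-]; rewrite lecR.
    exact: (ub_le_sup supA.2).
  move=> b ub_b.
  have ub_r r : A r -> r%:C%C <= b.
    by move=> Ar; apply: ub_b; rewrite BA; exists r.
  move: (ub_r _ Aa) (ub_r) => {ub_b ub_r}; case: b => b1 b2.
  rewrite !lecE/= => /andP[/eqP -> _] ub; rewrite eqxx/=.
  by apply: ge_sup; [exists a|move=> r /ub; rewrite lecE/= => /andP[]].
rewrite /supremum ifF; last by apply/negbTE/set0P; rewrite BA; exists a%:C%C, a.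
by case: xgetP => [_ -> /is_subset1_supremums|/(_ _ supB)//]; apply.
Qed.

Definition sup_ball (X : topologicalType) (K : numFieldType)
  (f : continuousType X K) (r : K) : set (continuousType X K) :=
  [set g | sup_norm (g - f) < r].

Definition open_multiplication (X : topologicalType) (K : numFieldType) :=
  forall (f g : continuousType X K) (e : K), 0 < e ->
  exists2 d : K, 0 < d & sup_ball (f * g) d `<=`
    [set u * v | u in sup_ball f e & v in sup_ball g e].

(* dim X <= n. The order of the refinement V is counted on indices, which is
   the same as counting members since repetitions can be dropped from V. *)
Definition covering_dim_le (X : topologicalType) (n : nat) :=
  forall (k : nat) (U : 'I_k -> set X),
    (forall i, open (U i)) -> \bigcup_i U i = [set: X] ->
  exists (l : nat) (V : 'I_l -> set X),
    [/\ forall j, open (V j), \bigcup_j V j = [set: X],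
        forall j, exists i, V j `<=` U i
      & forall x, (#|[pred j | x \in V j]| <= n.+1)%N].

(* n <= dim X for n : nat; the cases dim X = -1 (X empty) and dim X = +oo
   are covered, the first because then covering_dim_le X 0. *)
Definition covering_dim_ge (X : topologicalType) (n : nat) :=
  forall m, covering_dim_le X m -> (n <= m)%N.

(* Main.v *)
Require Import Defs.
From mathcomp Require Import all_boot all_order all_algebra.
From mathcomp Require Import all_classical all_reals all_analysis.
From mathcomp Require Import lra.
Import Order.TTheory GRing.Theory Num.Theory.
Import numFieldNormedType.Exports.

Local Open Scope classical_set_scope.
Local Open Scope ring_scope.

(* If multiplication is open at [(f, conj f)], then [|f|^2 + c], for a small
   constant [c > 0], factors as [u * v] with [u] close to [f]; as the product
   vanishes nowhere, so does [u]. Hence every map from [X] to the plane is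
   uniformly approximable by maps that avoid the origin. Applied to
   [(phi_0 - phi_2, phi_1 - phi_2)] for functions [phi_i] subordinate to an open
   cover by three sets, this moves a map into the triangle off its barycentre,
   and so shrinks the cover to one without triple intersection. This property of
   three-element covers forces the covering dimension to be at most 1. *)

(** * Urysohn functions subordinate to a finite open cover *)

Lemma open_fun_lt {R : realType} {X : topologicalType} (f g : X -> R) :
  continuous f -> continuous g -> open [set x | f x < g x].
Proof.
move=> cf cg.
rewrite (_ : mkset _ = (g \- f) @^-1` [set y | 0 < y]); last first.
  by apply/seteqP; split=> x /=; rewrite subr_gt0.
apply: open_comp; last exact: open_gt.
by move=> x _; apply: continuousB; [exact: cg|exact: cf].
Qed.

Lemma urysohn_cover {R : realType} {X : topologicalType} (A B : set X) :
  normal_space X -> open A -> open B -> A `|` B = [set: X] ->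
  exists f : X -> R, [/\ continuous f, forall x, 0 <= f x,
    forall x, ~ A x -> f x = 0 & forall x, ~ B x -> f x = 1].
Proof.
move=> nX oA oB AB.
have /(uniform_separatorP (R := R)) [f [cf f01 f0 f1]] :
    uniform_separator (~` A) (~` B).
  apply: (normal_separatorP (R := R)).1 => //; [exact: open_closedC..|].
  by rewrite -setCU AB setCT.
exists f; split=> // x.
- by have /f01 /= : range f (f x) by []; rewrite in_itv/= => /andP[].
- by move=> nAx; apply: f0; exists x.
- by move=> nBx; apply: f1; exists x.
Qed.

(** Induction on the list [s] of indices already given a function: the sets [U j], cut down to
    [phi j > 1/2] when [j] is in [s], must still cover [X]. *)
Lemma normal_cover_functions {R : realType} {X : topologicalType} (n : nat)
    (U : 'I_n -> set X) :
  normal_space X -> (forall i, open (U i)) -> \bigcup_i U i = [set: X] ->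
  exists phi : 'I_n -> X -> R,
    [/\ forall i, continuous (phi i), forall i x, 0 <= phi i x,
        forall i x, ~ U i x -> phi i x = 0
      & forall x, exists i, 2^-1 < phi i x].
Proof.
move=> nX oU cU.
suff H (s : seq 'I_n) : exists phi : 'I_n -> X -> R,
    [/\ forall i, continuous (phi i), forall i x, 0 <= phi i x,
        forall i x, ~ U i x -> phi i x = 0
      & forall x, exists i, (i \in s -> 2^-1 < phi i x) /\ U i x].
  have [phi [c p0 pU p1]] := H (enum 'I_n).
  exists phi; split=> // x; have [i [+ _]] := p1 x.
  by rewrite mem_enum => /(_ isT); exists i.
elim: s => [|i s [phi [c p0 pU p1]]].
  exists (fun _ _ => 0); split=> //; first by move=> i x; exact: cvg_cst.
  by move=> x; have : setT x by []; rewrite -cU => -[i _ Ux]; exists i.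
pose C j := U j `&` [set x | j \in s -> 2^-1 < phi j x].
have oC j : open (C j).
  apply: openI => //; have [js|js] := boolP (j \in s).
    rewrite (_ : mkset _ = [set x | cst 2^-1 x < phi j x]).
      by apply: open_fun_lt => //; exact: cst_continuous.
    by apply/seteqP; split=> x /=; [exact|move=> ? _].
  by rewrite (_ : mkset _ = setT); [exact: openT|apply/seteqP; split].
(* Points outside [B] are covered by [U i] alone; the new function for [i] equals 1 there and
   vanishes off [U i]. *)
pose B := \bigcup_(j in [set j | j != i]) C j.
have UB : U i `|` B = setT.
  apply/seteqP; split=> // x _; have [j [js Ux]] := p1 x.
  by have [<-|ji] := eqVneq j i; [left|right; exists j; rewrite /C].
have [f [cf f0 fU fB]] := urysohn_cover (R := R) _ _ nX (oU i)
  (bigcup_open (fun j _ => oC j)) UB.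
exists (fun j => if j == i then f else phi j); split.
- by move=> j; case: ifP.
- by move=> j x; case: ifP.
- by move=> j x; case: ifP => [/eqP ->|_]; [exact: fU|exact: pU].
move=> x; have [[j /= ji [Ux jx]]|nB] := pselect (B x).
  by exists j; rewrite inE (negbTE ji).
exists i; rewrite eqxx fB//; split; first by move=> _; lra.
by have [] : (U i `|` B) x by rewrite UB.
Qed.

(** * Three-element covers and covering dimension at most 1 *)

(** Only comparisons between the values of [psi] matter, so the diagonal of R^3 stands for the
    barycentre and the functions need not sum to 1. *)
Lemma cover3_shrinking {R : realType} {X : topologicalType} :
  normal_space X ->
  (forall phi : 'I_3 -> X -> R, (forall i, continuous (phi i)) ->
    exists psi : 'I_3 -> X -> R, [/\ forall i, continuous (psi i),
      forall i x, `|psi i x - phi i x| < 4^-1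
      & forall x, exists i j, psi i x < psi j x]) ->
  forall U : 'I_3 -> set X,
    (forall i, open (U i)) -> \bigcup_i U i = [set: X] ->
  exists W : 'I_3 -> set X, [/\ forall i, open (W i), \bigcup_i W i = [set: X],
    forall i, W i `<=` U i & forall x, exists i, ~ W i x].
Proof.
move=> nX approx U oU cU.
have [phi [cphi p0 pU p1]] := normal_cover_functions (R := R) _ _ nX oU cU.
have [psi [cpsi near sep]] := approx phi cphi.
(* At most two of the conditions "[psi i] exceeds the minimum" hold at a point;
   where some [phi j] vanishes, the index of a [phi i > 1/2] satisfies it since
   [psi] is within 1/4 of [phi]. *)
exists (fun i => [set x | cst 0 x < phi i x] `&`
  \bigcup_j [set x | psi j x < psi i x]); split.
- move=> i; apply: openI; first by apply: open_fun_lt => //; exact: cst_continuous.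
  by apply: bigcup_open => j _; exact: open_fun_lt.
- apply/seteqP; split=> // x _.
  have [[j pj]|npj] := pselect (exists j, phi j x <= 0).
    have [i pi] := p1 x; exists i => //; split=> /=; first lra.
    exists j => //=; have := near i x; have := near j x.
    rewrite !ltr_norml => /andP[_ ?] /andP[? _]; lra.
  have [j [i ji]] := sep x; exists i => //; split=> /=; last by exists j.
  by rewrite ltNge; apply/negP => ?; apply: npj; exists i.
- move=> i x [/= px _]; apply: contrapT => /pU pix.
  by rewrite pix ltxx in px.
(* An index minimising [psi] at [x] exceeds no other, so its set misses [x]. *)
- move=> x; pose i := [arg min_(i < ord0) psi i x]%O; exists i => -[_ [j _ /=]].
  rewrite /i; case: arg_minP => // k _ /(_ j isT) kj.
  by rewrite ltNge kj.
Qed.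

(* Merging all but two members of the cover into one reduces each triple to the
   case of a cover by three sets; shrinking further keeps the triples already
   dealt with disjoint. *)
Lemma covering_dim_le1 {X : topologicalType} :
  (forall U : 'I_3 -> set X,
    (forall i, open (U i)) -> \bigcup_i U i = [set: X] ->
    exists W : 'I_3 -> set X, [/\ forall i, open (W i),
      \bigcup_i W i = [set: X],
      forall i, W i `<=` U i & forall x, exists i, ~ W i x]) ->
  covering_dim_le X 1.
Proof.
move=> shrink k U oU cU.
suff H (s : seq ('I_k * 'I_k * 'I_k)) : exists V : 'I_k -> set X,
    [/\ forall j, open (V j), \bigcup_j V j = [set: X],
        forall j, V j `<=` U j
      & forall i j l x, (i, j, l) \in s -> i != j -> j != l -> l != i ->
          ~ [/\ V i x, V j x & V l x]].
  have [V [oV cV VU V3]] := H (enum {: 'I_k * 'I_k * 'I_k}).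
  exists k, V; split=> // [j|x]; first by exists j.
  rewrite leqNgt; apply/negP => /card_gt2P[i [j [l]]].
  rewrite !inE => -[[Vi Vj Vl] [ij jl li]].
  have /V3 : (i, j, l) \in enum {: 'I_k * 'I_k * 'I_k} by rewrite mem_enum.
  by move=> /(_ x ij jl li); apply.
elim: s => [|[[i j] l] s [V [oV cV VU V3]]]; first by exists U; split=> // ? ?.
have [/and3P[ij jl li]|nijl] := boolP [&& i != j, j != l & l != i]; last first.
  exists V; split=> // i' j' l' x.
  rewrite inE => /orP[/eqP[-> -> ->]|]; last exact: V3.
  by move=> ij jl li; rewrite ij jl li in nijl.
(* Classes 0 and 1 are [i] and [j] alone; class 2 holds the rest, including [l]. *)
pose cls m : 'I_3 := if m == i then 0 else if m == j then 1 else 2%:R.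
have oM t : open (\bigcup_(m in [set m | cls m = t]) V m).
  by apply: bigcup_open => m _; exact: oV.
have cM : \bigcup_t \bigcup_(m in [set m | cls m = t]) V m = [set: X].
  apply/seteqP; split=> // x _; have : setT x by [].
  by rewrite -cV => -[m _ Vx]; exists (cls m) => //; exists m.
have [W [oW cW WM W0]] := shrink _ oM cM.
exists (fun m => V m `&` W (cls m)); split.
- by move=> m; apply: openI.
- apply/seteqP; split=> // x _; have : setT x by [].
  rewrite -cW => -[t _ Wx]; have [m /= mt Vx] := WM _ _ Wx.
  by exists m => //; split=> //; rewrite mt.
- by move=> m x [/VU].
move=> i' j' l' x; rewrite inE => /orP[/eqP[-> -> ->] _ _ _|]; last first.
  move=> ? ? ? ? [[? _] [? _] [? _]]; exact: (V3 i' j' l' x).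
rewrite /cls eqxx eq_sym (negbTE ij) eqxx (negbTE li) eq_sym (negbTE jl).
case=> -[_ Wi] [_ Wj] [_ Wl]; have [t] := W0 x.
have : t \in [:: 0; 1; 2%:R : 'I_3] by case: t => -[|[|[|]]].
by rewrite !inE => /or3P[]/eqP ->.
Qed.

Lemma covering_dim_le1_of_approx {R : realType} {X : topologicalType} :
  compact [set: X] -> hausdorff_space X ->
  (forall a b : X -> R, continuous a -> continuous b ->
    exists a' b' : X -> R, [/\ continuous a', continuous b',
      forall x, `|a' x - a x| < 4^-1, forall x, `|b' x - b x| < 4^-1
      & forall x, a' x = 0 -> b' x = 0 -> False]) ->
  covering_dim_le X 1.
Proof.
move=> cX hX approx; apply: covering_dim_le1.
apply: (cover3_shrinking (R := R)); first exact: compact_normal.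
move=> phi cphi.
have [||a [b [ca cb na nb ab]]] := approx (phi 0 \- phi 2%:R) (phi 1 \- phi 2%:R).
- by move=> x; apply: continuousB; exact: cphi.
- by move=> x; apply: continuousB; exact: cphi.
pose d (i : 'I_3) := if i == 0 then a else if i == 1 then b else cst 0.
have cd i : continuous (d i).
  by rewrite /d; do 2?case: ifP => // _; exact: cst_continuous.
(* Keeping [phi 2] fixed turns the errors of [a] and [b] into those of [psi 0] and [psi 1]; all
   three values agree only where [a] and [b] both vanish. *)
exists (fun i => phi 2%:R \+ d i); split.
- by move=> i x; apply: continuousD; [exact: cphi|exact: cd].
- move=> i x.
  have : i \in [:: 0; 1; 2%:R : 'I_3] by case: i => -[|[|[|]]].
  rewrite !inE /d => /or3P[]/eqP -> /=.
  + by rewrite (addrC (phi _ _)) -addrA -opprB; exact: na.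
  + by rewrite (addrC (phi _ _)) -addrA -opprB; exact: nb.
  + by rewrite addr0 subrr normr0; lra.
- move=> x; have := ab x.
  have d0 : d 0 x = a x by [].
  have d1 : d 1 x = b x by [].
  have d2 : d 2%:R x = 0 by [].
  case: (ltrgtP (a x) 0) => [a0|a0|a0].
  + by exists 0, 2%:R; rewrite /= d0 d2; lra.
  + by exists 2%:R, 0; rewrite /= d0 d2; lra.
  case: (ltrgtP (b x) 0) => [b0|b0|b0].
  + by exists 1, 2%:R; rewrite /= d1 d2; lra.
  + by exists 2%:R, 1; rewrite /= d1 d2; lra.
  by move=> /(_ a0 b0).
Qed.

(** * Nowhere vanishing approximations from open multiplication *)

Lemma open_multiplication_approx_unit (X : topologicalType) (K : numFieldType)
    (f g : continuousType X K) (e : K) :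
  open_multiplication X K -> inhabited X -> 0 < e ->
  (forall x, 0 <= f x * g x) ->
  exists u : continuousType X K, sup_norm (u - f) < e /\ forall x, u x != 0.
Proof.
move=> openM [x0] e0 fg0; have [d d0 sub] := openM f g e e0.
have ch : continuous (fun x => f x * g x + d / 2).
  move=> x; apply: cvgD; last exact: cvg_cst.
  by apply: cvgM; exact: cts_fun.
pose h : continuousType X K := cfun_Sub (mem_set ch).
have hE x : h x = f x * g x + d / 2 by [].
have /sub[u uf [v _ uv]] : sup_ball (f * g) d h.
  (* The perturbation is constant, so its modulus has a one-point range, whose supremum exists over
     every [K]. *)
  have E x : `|(h - f * g) x| = d / 2.
    by rewrite cfunB cfunM hE addrC addKr ger0_norm// divr_ge0// ltW.
  have rE : range (fun x => `|(h - f * g) x|) = [set d / 2].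
    by apply/seteqP; split=> [_ [x _ <-]|_ ->]; [exact: E|exists x0; rewrite ?E].
  by rewrite /sup_ball /= /sup_norm rE supremum1 gtr_pMr// invf_lt1// ltr1n.
exists u; split=> // x; apply/eqP => ux0.
have : 0 < h x by rewrite hE ltr_wpDl// divr_gt0.
by rewrite -uv cfunM ux0 mul0r ltxx.
Qed.

(** * The supremum norm and continuity of complex-valued functions *)

(** Compactness bounds the range; on an unbounded one [sup] would take its default value 0. *)
Lemma le_sup_range {R : realType} {X : topologicalType} (h : X -> R) (x : X) :
  compact [set: X] -> continuous h -> h x <= sup (range h).
Proof.
move=> cX ch; apply: ub_le_sup; last by exists x.
have [] // := @compact_has_sup R (range h); first by exists (h x), x.
by apply: continuous_compact => //; exact: continuous_subspaceT.
Qed.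

Lemma sup_normR_ub {R : realType} {X : topologicalType}
    (f : continuousType X R) (x : X) :
  compact [set: X] -> `|f x| <= sup_norm f.
Proof.
move=> cX; rewrite sup_normR; apply: (le_sup_range (fun x => `|f x|)) => // y.
by apply: cvg_norm; exact: cts_fun.
Qed.

Lemma normc_ge_Im {R : rcfType} (z : R[i]) : (`|complex.Im z|)%:C%C <= `|z|.
Proof.
case: z => a b; rewrite normc_def lecR/= -sqrtr_sqr ler_wsqrtr//.
by rewrite lerDr sqr_ge0.
Qed.

Lemma continuous_Re {R : realType} {X : topologicalType}
    (f : X -> (R[i] : numFieldType)) :
  continuous f -> continuous (fun x => complex.Re (f x)).
Proof.
move=> cf x; apply/cvgrPdist_lt => e e0.
have /cvgrPdist_lt/(_ e%:C%C) := cf x; rewrite ltcR => /(_ e0).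
apply: filterS => t; rewrite -ltcR; apply: le_lt_trans.
by rewrite -raddfB; exact: normc_ge_Re.
Qed.

Lemma continuous_Im {R : realType} {X : topologicalType}
    (f : X -> (R[i] : numFieldType)) :
  continuous f -> continuous (fun x => complex.Im (f x)).
Proof.
move=> cf x; apply/cvgrPdist_lt => e e0.
have /cvgrPdist_lt/(_ e%:C%C) := cf x; rewrite ltcR => /(_ e0).
apply: filterS => t; rewrite -ltcR; apply: le_lt_trans.
by rewrite -raddfB; exact: normc_ge_Im.
Qed.

Lemma continuous_real_complex {R : realType} {X : topologicalType} (a : X -> R) :
  continuous a -> continuous (fun x => (a x)%:C%C : (R[i] : numFieldType)).
Proof.
(* A radius that is positive in the partial order of [R[i]] has imaginary part 0. *)
move=> ca x; apply/cvgrPdist_lt => -[e1 e2]; rewrite ltcE/= => /andP[/eqP -> e0].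
have /cvgrPdist_lt/(_ e1 e0) := ca x.
apply: filterS => t at_; rewrite -rmorphB normc_def/= expr0n/= addr0 sqrtr_sqr.
by rewrite ltcR.
Qed.

Lemma continuous_complex {R : realType} {X : topologicalType} (a b : X -> R) :
  continuous a -> continuous b ->
  continuous (fun x => (a x +i* b x)%C : (R[i] : numFieldType)).
Proof.
move=> ca cb; under eq_fun => x do rewrite [(_ +i* _)%C]complexE.
move=> x; apply: cvgD; first exact: continuous_real_complex.
by apply: cvgM; [exact: cvg_cst|exact: continuous_real_complex].
Qed.

Lemma sup_normC_ub {R : realType} {X : topologicalType}
    (f : continuousType X (R[i] : numFieldType)) (x : X) :
  compact [set: X] -> `|f x| <= sup_norm f.
Proof.
move=> cX; rewrite sup_normC; rewrite -[`|f x|]/((Normc.normc (f x))%:C)%C lecR.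
apply: (le_sup_range (fun x => Normc.normc (f x))) => //.
(* The norm of [R[i]] is [R[i]]-valued, and its real part is the real modulus. *)
apply: (continuous_Re (fun x => `|f x|)) => y.
by apply: cvg_norm; exact: cts_fun.
Qed.

Theorem proposition4p4 (R : realType) (X : topologicalType)
    (X_compact : compact [set: X]) (X_hausdorff : hausdorff_space X)
    (dim_ge2 : covering_dim_ge X 2) :
  ~ open_multiplication X R /\ ~ open_multiplication X R[i].
Proof.
suff approx : open_multiplication X R \/ open_multiplication X R[i] ->
    forall a b : X -> R, continuous a -> continuous b ->
    exists a' b' : X -> R, [/\ continuous a', continuous b',
      forall x, `|a' x - a x| < 4^-1, forall x, `|b' x - b x| < 4^-1
      & forall x, a' x = 0 -> b' x = 0 -> False].
  (* Dimension at most 1 would give [2 <= 1]. *)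
  by split=> openM; have /dim_ge2 : covering_dim_le X 1 by
    apply: (covering_dim_le1_of_approx (R := R)) => //; apply: approx; tauto.
move=> openM a b ca cb.
have [X0|X0] := pselect (inhabited X); last first.
  by exists a, b; split=> // x; case: X0.
case: openM => openM.
  (* Over the reals, [f * f] is nonnegative, so [a] alone can be moved off 0 and [b] kept. *)
  pose f : continuousType X R := cfun_Sub (mem_set ca).
  have [||u [uf u0]] := open_multiplication_approx_unit _ _ f f 4^-1 openM X0.
  - by lra.
  - by move=> x; rewrite -expr2 sqr_ge0.
  exists u, b; split=> //.
  + by move=> x; exact: cts_fun.
  + by move=> x; apply: le_lt_trans uf; exact: (sup_normR_ub (u - f)).
  + by move=> x; rewrite subrr normr0; lra.
  + by move=> x /eqP ux; move: (u0 x); rewrite ux.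
pose f : continuousType X (R[i] : numFieldType) :=
  cfun_Sub (mem_set (continuous_complex _ _ ca cb)).
have cNb : continuous (\- b) by move=> x; apply: continuousN; exact: cb.
(* [g] is the conjugate of [f = a + i b], so [f * g] is the squared modulus of [f]. *)
pose g : continuousType X (R[i] : numFieldType) :=
  cfun_Sub (mem_set (continuous_complex _ _ ca cNb)).
have [||u [uf u0]] := open_multiplication_approx_unit _ _ f g (4^-1)%:C%C openM X0.
- by rewrite ltcR; lra.
- by move=> x; rewrite -[g x]/((f x)^*)%C -sqr_normc exprn_ge0.
have near x : `|u x - f x| < (4^-1)%:C%C.
  by apply: le_lt_trans uf; exact: (sup_normC_ub (u - f)).
exists (fun x => complex.Re (u x)), (fun x => complex.Im (u x)); split.
- by apply: continuous_Re => x; exact: cts_fun.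
- by apply: continuous_Im => x; exact: cts_fun.
- move=> x; rewrite -ltcR; apply: le_lt_trans (near x).
  by rewrite -[a x]/(complex.Re (f x)) -raddfB; exact: normc_ge_Re.
- move=> x; rewrite -ltcR; apply: le_lt_trans (near x).
  by rewrite -[b x]/(complex.Im (f x)) -raddfB; exact: normc_ge_Im.
- move=> x ua ub; move/eqP: (u0 x); apply.
  by case: (u x) ua ub => ? ? /= -> ->.
Qed.
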